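(* Suppose Assumptions 1, 2 and 3 hold and $f$ is twice continuously differentiable. Let $\delta>0$ and $\beta\in(0,1)$, and let $C=C(\beta)$ be the smallest positive integer $C$ with $\frac C2\beta^C\le\frac{1}{1-\beta^2}\frac{1}{C+1}$ and $\beta^{C+1}\le\frac12$. Run \textsc{Signum} from $x_0$: at step $k\ge0$ draw a mini-batch stochastic gradient $\tilde g_k$ of size $n_k=k+1$ at $x_k$, form $$\tilde m_k=\frac{1-\beta}{1-\beta^{k+1}}\sum_{t=0}^k\beta^t\tilde g_{k-t},$$ and set $\delta_k=\delta/\sqrt{k+1}$ and $$x_{k+1}=\begin{cases}x_k-\delta_k\,\mathrm{sign}(\tilde g_k), & k<C \ \text{(warmup)},\\ x_k-\delta_k\,\mathrm{sign}(\tilde m_k), & k\ge C.\end{cases}$$ (Equivalently, with $m_0=0$ and $m_{k+1}=\beta m_k+(1-\beta)\tilde g_k$, $\mathrm{sign}(\tilde m_k)=\mathrm{sign}(m_{k+1})$.) Let $N=\sum_{k=0}^{K-1}n_k$ be the number of oracle calls up to step $K$, and $f_C:=\mathbb{E}[f(x_C)]$. Then there exist constants $A>0$ and $K_0$, depending only on $\beta$, such that for all $K\ge K_0$, $$\left(\mathbb{E}\Big[\frac{1}{K-C}\sum_{k=C}^{K-1}\|g_k\|_1\Big]\right)^2\le\frac{A}{\sqrt N}\left[\frac{f_C-f_*}{\delta}+(1+\log N)\Big(\frac{\delta\|\vec L\|_1}{1-\beta}+\|\vec\sigma\|_1\sqrt{1-\beta}\Big)\right]^2,$$ where $g_k=\nabla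 f(x_k)$.
   Context: $f:\mathbb{R}^d\to\mathbb{R}$ with gradient $g(x)=\nabla f(x)$. Assumption 1: there is a constant $f_*$ with $f(x)\ge f_*$ for all $x$. Assumption 2: there is a vector $\vec L=(L_1,\dots,L_d)$ of non-negative constants such that for all $x,y$, $\big|f(y)-f(x)-g(x)^T(y-x)\big|\le \frac12\sum_{i=1}^d L_i(y_i-x_i)^2$. Assumption 3: upon query $x$, a stochastic gradient oracle returns a random vector $\tilde g(x)$, independent of all other oracle calls, with $\mathbb{E}[\tilde g(x)]=g(x)$ and $\mathbb{E}[(\tilde g(x)_i-g(x)_i)^2]\le\sigma_i^2$ for a vector $\vec\sigma$ of non-negative constants. A mini-batch stochastic gradient of size $n$ at $x$ is the average of $n$ independent oracle calls at $x$. $\mathrm{sign}$ acts componentwise, with $\mathrm{sign}(0)=0$. *)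

(* Defs.v *)
From HB Require Import structures.
From mathcomp Require Import all_boot all_order all_algebra.
From mathcomp Require Import all_classical all_reals all_analysis.
Set Implicit Arguments. Unset Strict Implicit. Unset Printing Implicit Defensive.
Import Order.TTheory GRing.Theory Num.Theory.
Import numFieldNormedType.Exports.
Local Open Scope classical_set_scope.
Local Open Scope ring_scope.

Definition partial (R : realType) (d : nat) (i : 'I_d) (h : 'rV[R]_d -> R)
  (x : 'rV[R]_d) : R := 'D_(delta_mx ord0 i) h x.

Definition grad (R : realType) (d : nat) (f : 'rV[R]_d -> R) (x : 'rV[R]_d)
  : 'rV[R]_d := \row_i partial i f x.

Definition twice_cont_diff (R : realType) (d : nat) (f : 'rV[R]_d -> R) : Prop :=
  (forall x, differentiable f x) /\
  (forall i x, differentiable (partial i f) x) /\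
  (forall i j, continuous (partial j (partial i f))).

Definition norm1 (R : realType) (d : nat) (v : 'rV[R]_d) : R :=
  \sum_(i < d) `|v ord0 i|.

(* componentwise sign, with sign 0 = 0 *)
Definition sgnv (R : realType) (d : nat) (v : 'rV[R]_d) : 'rV[R]_d :=
  map_mx (fun a => Num.sg a) v.

Definition borel_rV (R : realType) (d : nat) := g_sigma_algebraType (@open 'rV[R]_d).

Definition mutually_independent (R : realType) (dT dO : measure_display)
  (T : measurableType dT) (O : measurableType dO) (P : probability T R)
  (I : eqType) (X : I -> T -> O) : Prop :=
  forall (s : seq I) (A : I -> set O), uniq s -> (forall i, measurable (A i)) ->
    P (\bigcap_(i in [set i | i \in s]) (X i @^-1` A i)) =
    (\prod_(i <- s) P (X i @^-1` A i))%E.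

Definition signum_C_cond (R : realType) (beta : R) (C : nat) : Prop :=
  (C%:R / 2 * beta ^+ C <= (1 - beta ^+ 2)^-1 * (C.+1%:R)^-1) /\
  (beta ^+ C.+1 <= 2^-1).

Definition is_signum_C (R : realType) (beta : R) (C : nat) : Prop :=
  (0 < C)%N /\ signum_C_cond beta C /\
  (forall C', (0 < C')%N -> signum_C_cond beta C' -> (C <= C')%N).

(* One run of Signum for a fixed realisation w : nat -> nat -> Omega of the
   oracle noise (w k j is the noise of the j-th oracle call in step k).
   The oracle answer at query x with noise w is G x w.  The state is
   (x_k, m_k) with m_0 = 0, m_{k+1} = beta m_k + (1-beta) gt_k, so that
   m_{k+1} = (1-beta) sum_{t<=k} beta^t gt_{k-t} and
   tilde m_k = (1 - beta^(k+1))^-1 m_{k+1}. *)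
Section Signum.
Variables (R : realType) (d : nat) (Omega : Type)
  (G : 'rV[R]_d -> Omega -> 'rV[R]_d) (beta delta : R) (C : nat)
  (x0 : 'rV[R]_d) (w : nat -> nat -> Omega).

Definition minibatch (x : 'rV[R]_d) (k : nat) : 'rV[R]_d :=
  (k.+1%:R)^-1 *: \sum_(j < k.+1) G x (w k j).

Fixpoint signum_state (k : nat) : 'rV[R]_d * 'rV[R]_d :=
  match k with
  | 0%N => (x0, 0)
  | k'.+1 =>
    let xm := signum_state k' in
    let gt := minibatch xm.1 k' in
    let m' := beta *: xm.2 + (1 - beta) *: gt in
    let mt := (1 - beta ^+ k'.+1)^-1 *: m' in
    let dk := delta / Num.sqrt (k'.+1%:R) in
    (xm.1 - dk *: (if (k' < C)%N then sgnv gt else sgnv mt), m')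
  end.

Definition signum_iter (k : nat) : 'rV[R]_d := (signum_state k).1.
End Signum.

(* Main.v *)
Require Import Defs.
From HB Require Import structures.
From mathcomp Require Import all_boot all_order all_algebra.
From mathcomp Require Import all_classical all_reals all_analysis.
From mathcomp Require Import measurable_realfun zify ring lra.
Set Implicit Arguments. Unset Strict Implicit. Unset Printing Implicit Defensive.
Import Order.TTheory GRing.Theory Num.Theory.
Import numFieldNormedType.Exports.
Local Open Scope classical_set_scope.
Local Open Scope ring_scope.

(* Along every sample path Assumption 2 gives, for k >= C, a descent inequality
   in which |g_i| (1 - sign(g_i) sign(m~_i)) <= 2 |m~_i - g_i|.  The unnormalised
   momentum error e_k = m_{k+1} - (1 - beta^(k+1)) g_k obeys
     ||e_{k+1}|| <= beta ||e_k|| + 3 delta_k ||L||_1 + ||z_{k+1}||,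
   where z_k is the mini-batch noise, since ||g_{k+1} - g_k||_1 is at most
   3 delta_k ||L||_1; summing against 1/sqrt(k+1) bounds the total momentum
   error by the total noise plus ||L||_1 times a harmonic sum.  As the constant
   may depend on beta, no variance reduction across steps is needed, only
   E ||z_k||_1 <= ||sigma||_1 / sqrt(k+1).  For this, the iterate x_k takes
   finitely many values, and each event {x_k = v} belongs to the sigma-algebra of
   the oracle calls of the steps before k, hence is independent of those of
   step k. *)

(** * Pathwise analysis *)

Section Norm1.
Variables (R : realType) (d : nat).
Implicit Types u v : 'rV[R]_d.

Lemma norm1_ge0 v : 0 <= norm1 v.
Proof. by apply: sumr_ge0. Qed.

Lemma norm1D u v : norm1 (u + v) <= norm1 u + norm1 v.
Proof.
by rewrite /norm1 -big_split; apply: ler_sum => i _; rewrite mxE ler_normD.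
Qed.

Lemma norm1Z (a : R) v : norm1 (a *: v) = `|a| * norm1 v.
Proof.
by rewrite /norm1 mulr_sumr; apply: eq_bigr => i _; rewrite mxE normrM.
Qed.

End Norm1.

(** * Variation of the gradient under coordinatewise smoothness *)

Section Smoothness.
Variables (R : realType) (d : nat) (f : 'rV[R]_d -> R) (L : 'I_d -> R).
Hypothesis L_ge0 : forall i, 0 <= L i.
Hypothesis smooth : forall x y : 'rV[R]_d,
  `| f y - f x - \sum_(i < d) grad f x ord0 i * (y ord0 i - x ord0 i) |
  <= 2^-1 * \sum_(i < d) L i * (y ord0 i - x ord0 i) ^+ 2.

Let lin (x v : 'rV[R]_d) : R := \sum_(i < d) grad f x ord0 i * v ord0 i.

(** Sign steps are controlled coordinate by coordinate, so the quadratic form of Assumption 2 is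
    replaced by its value at a corner of the cube of half-width [e]. *)
Lemma smooth_step (x v : 'rV[R]_d) (e : R) : (forall i, `|v ord0 i| <= e) ->
  `|f (x + v) - f x - lin x v| <= 2^-1 * e ^+ 2 * \sum_(i < d) L i.
Proof.
move=> ve; have xvE i : (x + v) ord0 i - x ord0 i = v ord0 i.
  by rewrite mxE addrAC subrr add0r.
have := smooth x (x + v).
under eq_bigr => i _ do rewrite xvE.
move=> /le_trans; apply.
rewrite -mulrA ler_wpM2l// mulr_sumr; apply: ler_sum => i _.
rewrite xvE mulrC ler_wpM2r//.
by rewrite -real_normK ?num_real// lerXn2r// ?nnegrE// (le_trans _ (ve i)).
Qed.

(* Both increments are compared with the value of [f] at the midpoint [c] of
   [x] and [y], where the first-order terms cancel. *)
Lemma norm1_gradB (x y : 'rV[R]_d) (e : R) : 0 < e ->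
  (forall i, `|y ord0 i - x ord0 i| <= e) ->
  norm1 (grad f y - grad f x) <= 3 * e * \sum_(i < d) L i.
Proof.
move=> e0 xye; set S := \sum_(i < d) L i.
have S0 : 0 <= S by exact: sumr_ge0.
pose h : 'rV[R]_d := 2^-1 *: (y - x); pose c : 'rV[R]_d := x + h.
(* Sign vectors are dual to the 1-norm: this [u] turns [lin y u - lin x u] into [e / 2] times the
   norm to be bounded. *)
pose u : 'rV[R]_d :=
  (e / 2) *: \row_i Num.sg (grad f y ord0 i - grad f x ord0 i).
have he i : `|h ord0 i| <= e / 2.
  by rewrite !mxE normrM gtr0_norm// mulrC ler_wpM2r// xye.
have ue i : `|u ord0 i| <= e / 2.
  have e2 : 0 <= e / 2 by rewrite divr_ge0// ltW.
  by rewrite mxE normrM (ger0_norm e2) mxE ler_piMr// normr_sg lern1 leq_b1.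
have hue i : `|(h + u) ord0 i| <= e.
  rewrite mxE (le_trans (ler_normD _ _))// (le_trans (lerD (he i) (ue i)))//.
  by rewrite -splitr.
have linN (p v : 'rV[R]_d) : lin p (- v) = - lin p v.
  by rewrite /lin -sumrN; apply: eq_bigr => i _; rewrite [(- v) _ _]mxE mulrN.
have Ne (v : 'rV[R]_d) (a : R) : (forall i, `|v ord0 i| <= a) ->
    forall i, `|(- v) ord0 i| <= a.
  by move=> va i; rewrite mxE normrN.
have key : e / 2 * norm1 (grad f y - grad f x) = lin y u - lin x u.
  rewrite /lin -sumrB /norm1 mulr_sumr; apply: eq_bigr => i _.
  have -> : u ord0 i = e / 2 * Num.sg (grad f y ord0 i - grad f x ord0 i).
    by rewrite mxE [X in _ * X]mxE.
  have -> : (grad f y - grad f x) ord0 i = grad f y ord0 i - grad f x ord0 i.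
    by rewrite mxE [X in _ + X]mxE.
  by rewrite normrEsg -mulrBl mulrA [LHS]mulrC.
have yE : c + h = y.
  rewrite /c /h -addrA -scalerDl.
  have -> : 2^-1 + 2^-1 = 1 :> R by rewrite [RHS]splitr div1r.
  by rewrite scale1r addrC subrK.
have xE : c - h = x by rewrite /c addrK.
have yuE : c + (h + u) = y + u by rewrite addrA yE.
have xuE : c - (h + u) = x - u by rewrite opprD addrA xE.
(* Four errors [e ^+ 2 / 8] and two errors [e ^+ 2 / 2], each times [S], add up to
   [e / 2 * (3 * e * S)]; hence the constant 3. *)
have := smooth_step y ue; rewrite ler_norml => /andP[H1 _].
have := smooth_step x (Ne _ _ ue); rewrite ler_norml => /andP[H2 _].
have := smooth_step c hue; rewrite ler_norml => /andP[_ H3].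
have := smooth_step c (Ne _ _ hue); rewrite ler_norml => /andP[_ H4].
have := smooth_step c he; rewrite ler_norml => /andP[H5 _].
have := smooth_step c (Ne _ _ he); rewrite ler_norml => /andP[H6 _].
have {}key : e / 2 * norm1 (grad f y - grad f x) <= e / 2 * (3 * e * S).
  move: H1 H2 H3 H4 H5 H6; rewrite {}key !linN yuE xuE yE xE -/S.
  move: (lin _ _) (lin _ _) (lin _ _) (lin _ _).
  move: (f _) (f _) (f _) (f _) (f _) => *; lra.
by rewrite ler_pM2l ?divr_gt0// in key.
Qed.

End Smoothness.

(** * Momentum error and descent along one sample path *)

Section SignumPath.
Variables (R : realType) (d : nat) (Omega : Type) (f : 'rV[R]_d -> R)
  (L : 'I_d -> R) (fstar : R) (G : 'rV[R]_d -> Omega -> 'rV[R]_d)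
  (beta delta : R) (C : nat) (x0 : 'rV[R]_d) (w : nat -> nat -> Omega).
Hypothesis L_ge0 : forall i, 0 <= L i.
Hypothesis smooth : forall x y : 'rV[R]_d,
  `| f y - f x - \sum_(i < d) grad f x ord0 i * (y ord0 i - x ord0 i) |
  <= 2^-1 * \sum_(i < d) L i * (y ord0 i - x ord0 i) ^+ 2.
Hypothesis f_ge : forall x, fstar <= f x.
Hypothesis beta01 : 0 < beta < 1.
Hypothesis delta_gt0 : 0 < delta.

Let state := signum_state G beta delta C x0 w.
Let x := signum_iter G beta delta C x0 w.
Let g k := grad f (x k).
Let noise k := minibatch G w (x k) k - g k.
Let Lsum := \sum_(i < d) L i.
Let a k : R := (Num.sqrt k.+1%:R)^-1.
(* [err k] is (1 - beta^(k+1)) (m~_k - g_k) in the notation of the paper. *)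
Let err k := (state k.+1).2 - (1 - beta ^+ k.+1) *: g k.

Let a_gt0 k : 0 < a k.
Proof. by rewrite invr_gt0 sqrtr_gt0 ltr0n. Qed.

Let a_ge0 k : 0 <= a k. Proof. exact: ltW. Qed.

Let a_decr k : a k.+1 <= a k.
Proof.
by rewrite lef_pV2 ?posrE ?sqrtr_gt0 ?ltr0n// ler_sqrt ?ler_nat ?ltr0n.
Qed.

Let Lsum_ge0 : 0 <= Lsum. Proof. exact: sumr_ge0. Qed.

Let beta_gt0 : 0 < beta. Proof. by case/andP: beta01. Qed.
Let beta_lt1 : beta < 1. Proof. by case/andP: beta01. Qed.
Let beta_ge0 : 0 <= beta. Proof. exact: ltW. Qed.
Let beta_le1 : beta <= 1. Proof. exact: ltW. Qed.
Let delta_ge0 : 0 <= delta. Proof. exact: ltW. Qed.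
Let onemb_gt0 : 0 < 1 - beta. Proof. by rewrite subr_gt0. Qed.
Let onemb_ge0 : 0 <= 1 - beta. Proof. exact: ltW. Qed.
Let onemb_le1 : 1 - beta <= 1. Proof. by rewrite gerBl. Qed.

(** Keeps the normalising factor of the momentum away from 0: dividing by it costs at most a factor
    [(1 - beta)^-1]. *)
Lemma beta_pow_bounds k : 1 - beta <= 1 - beta ^+ k.+1 <= 1.
Proof.
rewrite lerD2l lerN2 exprS ler_piMr ?exprn_ile1//=.
by rewrite gerBl mulr_ge0 ?exprn_ge0.
Qed.

(** Warmup and momentum steps both follow a vector of signs, so one bound serves every [k]. *)
Lemma signum_step_le k i : `|x k.+1 ord0 i - x k ord0 i| <= delta * a k.
Proof.
have -> : x k.+1 = x k - (delta / Num.sqrt k.+1%:R) *: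
    (if (k < C)%N then sgnv (minibatch G w (x k) k)
     else sgnv ((1 - beta ^+ k.+1)^-1 *: (state k.+1).2)) by [].
set s := if _ then _ else _.
have s1 : `|s ord0 i| <= 1.
  by rewrite /s; case: ifP => _; rewrite mxE normr_sg lern1 leq_b1.
rewrite mxE addrAC subrr add0r mxE normrN mxE normrM.
by rewrite ger0_norm ?mulr_ge0// ler_piMr// mulr_ge0.
Qed.

Lemma signum_err0 : err 0 = (1 - beta) *: noise 0.
Proof. by rewrite /err /= scaler0 add0r expr1 scalerBr. Qed.

(** Rests on the splitting [1 - beta ^+ k.+2 = beta * (1 - beta ^+ k.+1) + (1 - beta)]: the first
    part of the weight of [g k.+1] is compared with the old momentum, the second with the new
    mini-batch. *)
Lemma signum_errS k : err k.+1 =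
  beta *: err k + (beta * (1 - beta ^+ k.+1)) *: (g k - g k.+1)
  + (1 - beta) *: noise k.+1.
Proof.
apply/rowP => i; rewrite /err /noise.
have -> : (state k.+2).2 = beta *: (state k.+1).2 +
  (1 - beta) *: minibatch G w (x k.+1) k.+1 by [].
move: (g k) (g k.+1) => u v; rewrite !mxE [beta ^+ k.+2]exprS.
ring.
Qed.

(** The weights [beta * (1 - beta ^+ k.+1)] and [1 - beta] are bounded by 1; this loses only factors
    depending on [beta]. *)
Lemma norm1_signum_errS k : norm1 (err k.+1) <=
  beta * norm1 (err k) + 3 * delta * Lsum * a k + norm1 (noise k.+1).
Proof.
have /andP[b1 b2] := beta_pow_bounds k.
have b0 : 0 <= 1 - beta ^+ k.+1 by rewrite (le_trans _ b1).
have G1 : norm1 (g k - g k.+1) <= 3 * (delta * a k) * Lsum.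
  apply: norm1_gradB => //; first by rewrite mulr_gt0.
  by move=> i; rewrite distrC signum_step_le.
rewrite signum_errS (le_trans (norm1D _ _))// lerD//; last first.
  by rewrite norm1Z ger0_norm// ler_piMl ?norm1_ge0.
rewrite (le_trans (norm1D _ _))// lerD//.
  by rewrite norm1Z gtr0_norm.
rewrite norm1Z ger0_norm ?mulr_ge0//.
rewrite (_ : 3 * delta * Lsum * a k = 3 * (delta * a k) * Lsum); last by ring.
rewrite -[leRHS]mul1r ler_pM ?norm1_ge0//.
  by rewrite mulr_ge0.
by rewrite mulr_ile1.
Qed.

(** Since [a] decreases, weighting the recursion by [a k.+1] and summing reproduces at most [beta]
    times the same sum on the right; absorbing it leaves the factor [1 - beta]. *)
Lemma sum_norm1_signum_err K : (1 - beta) * \sum_(k < K) a k * norm1 (err k) <=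
  \sum_(k < K) a k * norm1 (noise k) + 3 * delta * Lsum * \sum_(k < K) a k ^+ 2.
Proof.
(* The contraction and drift terms stop one index earlier, as the recursion dictates; nonnegative
   last terms are added only after the induction. *)
have H n : \sum_(k < n.+1) a k * norm1 (err k) <=
    beta * (\sum_(k < n) a k * norm1 (err k))
    + \sum_(k < n.+1) a k * norm1 (noise k)
    + 3 * delta * Lsum * \sum_(k < n) a k ^+ 2.
  elim: n => [|n IHn].
    rewrite !big_ord0 !big_ord1 !mulr0 add0r addr0 signum_err0 norm1Z.
    by rewrite ler_wpM2l// ger0_norm// ler_piMl ?norm1_ge0.
  rewrite big_ord_recr/=.
  rewrite [X in beta * X]big_ord_recr [X in _ + X + _]big_ord_recr.
  rewrite [X in 3 * delta * Lsum * X]big_ord_recr/=.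
  have A1 : a n.+1 * norm1 (err n.+1) <= beta * (a n * norm1 (err n))
     + 3 * delta * Lsum * a n ^+ 2 + a n.+1 * norm1 (noise n.+1).
    apply: le_trans (ler_wpM2l (a_ge0 n.+1) (norm1_signum_errS n)) _.
    rewrite mulrDr lerD// mulrDr lerD//.
      by rewrite mulrCA ler_wpM2l// ler_wpM2r ?norm1_ge0.
    by rewrite mulrC expr2 mulrA ler_wpM2l// !mulr_ge0.
  move: IHn A1; rewrite -/(err n.+1) !mulrDr; lra.
case: K => [|K]; first by rewrite !big_ord0 !mulr0 addr0.
have H1 : beta * \sum_(k < K) a k * norm1 (err k) <=
    beta * \sum_(k < K.+1) a k * norm1 (err k).
  by rewrite ler_wpM2l// [leRHS]big_ord_recr/= lerDl mulr_ge0 ?norm1_ge0.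
have H2 : 3 * delta * Lsum * \sum_(k < K) a k ^+ 2 <=
    3 * delta * Lsum * \sum_(k < K.+1) a k ^+ 2.
  by rewrite ler_wpM2l ?mulr_ge0// [leRHS]big_ord_recr/= lerDl exprn_ge0.
rewrite mulrBl mul1r lerBlDr (le_trans (H K))//.
by rewrite [leRHS]addrC [leRHS]addrA lerD// lerD.
Qed.

Lemma signum_descent k : (C <= k)%N ->
  delta * a k * norm1 (g k) <= f (x k) - f (x k.+1)
    + 2 * delta / (1 - beta) * (a k * norm1 (err k))
    + 2^-1 * delta ^+ 2 * Lsum * a k ^+ 2.
Proof.
move=> Ck; have /andP[b1 _] := beta_pow_bounds k.
have b0 : 0 < 1 - beta ^+ k.+1 by rewrite (lt_le_trans _ b1).
pose mt := (1 - beta ^+ k.+1)^-1 *: (state k.+1).2.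
have xE i : (x k.+1 - x k) ord0 i = - (delta * a k * Num.sg (mt ord0 i)).
  have -> : x k.+1 = x k - (delta / Num.sqrt k.+1%:R) *:
    (if (k < C)%N then sgnv (minibatch G w (x k) k) else sgnv mt) by [].
  rewrite ltnNge Ck addrAC subrr add0r.
  by rewrite mxE mxE [sgnv _ _ _]mxE.
have sL i : `|(x k.+1 - x k) ord0 i| <= delta * a k.
  by rewrite mxE [(- x k) _ _]mxE signum_step_le.
have := smooth_step L_ge0 smooth (x k) sL.
rewrite [x k + _]addrC subrK ler_norml => /andP[_]; rewrite exprMn -/Lsum => D.
have mtE : delta * a k * norm1 (mt - g k) <=
    delta / (1 - beta) * (a k * norm1 (err k)).
  have -> : mt - g k = (1 - beta ^+ k.+1)^-1 *: err k.
    by rewrite /err scalerBr scalerA mulVf ?gt_eqF// scale1r.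
  rewrite norm1Z gtr0_norm ?invr_gt0// -!mulrA ler_wpM2l// mulrCA.
  by rewrite ler_wpM2r ?mulr_ge0 ?norm1_ge0// lef_pV2.
(* Coordinatewise this is [|u| - u * sg m <= 2 * |m - u|]: the left side vanishes when the signs
   agree, and otherwise it is at most [2 * |u|] with [|u| <= |m - u|]. *)
have S : delta * a k * norm1 (g k) +
    \sum_(i < d) g k ord0 i * (x k.+1 - x k) ord0 i <=
    2 * (delta * a k * norm1 (mt - g k)).
  rewrite /norm1 mulrCA !mulr_sumr -big_split; apply: ler_sum => i _.
  rewrite xE [(mt - _) ord0 i]mxE [(- g k) _ _]mxE.
  have : 0 <= delta * a k by rewrite mulr_ge0.
  move: (mt ord0 i) (g k ord0 i) (delta * a k) => m u c c0.
  have /= -> : c * `|u| + u * - (c * Num.sg m) = c * (`|u| - u * Num.sg m).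
    by ring.
  rewrite ler_wpM2l//.
  case: (sgrP m) => ?; case: (ger0P u) => ?; case: (ger0P (m - u)) => ?; lra.
move: D S mtE; rewrite -/(g k) => *; lra.
Qed.

(** Telescopes the descent inequality from [C] on. The noise sum starts at 0 because the momentum
    remembers the warmup mini-batches. The 6 is the 2 of the descent inequality times the 3 of the
    gradient drift. *)
Lemma sum_norm1_signum_grad K : (C <= K)%N ->
  \sum_(C <= k < K) delta * a k * norm1 (g k) <= f (x C) - fstar
    + 2 * delta / (1 - beta) ^+ 2 * (\sum_(k < K) a k * norm1 (noise k))
    + (2^-1 + 6 / (1 - beta) ^+ 2) * delta ^+ 2 * Lsum * \sum_(k < K) a k ^+ 2.
Proof.
move=> CK.
have H : \sum_(C <= k < K) delta * a k * norm1 (g k) <= f (x C) - f (x K)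
    + \sum_(C <= k < K) (2 * delta / (1 - beta) * (a k * norm1 (err k))
    + 2^-1 * delta ^+ 2 * Lsum * a k ^+ 2).
  rewrite -[X in X + _]opprB -(telescope_sumr (f \o x)) // -sumrN -big_split/=.
  apply: ler_sum_nat => k /andP[Ck _]; rewrite opprB addrA.
  exact: signum_descent.
have S (F : nat -> R) : (forall k, 0 <= F k) ->
    \sum_(C <= k < K) F k <= \sum_(k < K) F k.
  move=> F0; rewrite -(big_mkord xpredT F) (big_cat_nat (leq0n C) CK)/= lerDr.
  exact: sumr_ge0.
apply: le_trans H _; rewrite -[leRHS]addrA lerD ?lerD2l ?lerN2//.
apply: le_trans (S _ _) _ => [k|].
  by rewrite addr_ge0// !mulr_ge0 ?norm1_ge0 ?invr_ge0 ?sqr_ge0.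
rewrite big_split/= -!mulr_sumr.
have E := sum_norm1_signum_err K.
have {}E : 2 * delta / (1 - beta) * \sum_(k < K) a k * norm1 (err k) <=
  2 * delta / (1 - beta) ^+ 2 * (\sum_(k < K) a k * norm1 (noise k) +
    3 * delta * Lsum * \sum_(k < K) a k ^+ 2).
  have -> : 2 * delta / (1 - beta) = 2 * delta / (1 - beta) ^+ 2 * (1 - beta).
    by field; rewrite gt_eqF.
  by rewrite -mulrA ler_wpM2l// divr_ge0 ?mulr_ge0 ?sqr_ge0.
have -> : (2^-1 + 6 / (1 - beta) ^+ 2) * delta ^+ 2 * Lsum =
  2^-1 * delta ^+ 2 * Lsum + 2 * delta / (1 - beta) ^+ 2 * (3 * delta * Lsum).
  by field; rewrite gt_eqF.
move: E; rewrite mulrDr mulrDl -!mulrA; lra.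
Qed.

End SignumPath.

(** * Measurability of the iterates *)

Section FiniteRange.
Variables (R : realType) (d : nat) (dT : measure_display)
  (T : measurableType dT) (x : T -> 'rV[R]_d).
Hypothesis mx : forall i, measurable_fun setT (fun t => x t ord0 i).

Lemma measurable_fiber (v : 'rV[R]_d) : measurable [set t | x t = v].
Proof.
have -> : [set t | x t = v] =
    \bigcap_(i in [set: 'I_d]) ((fun t => x t ord0 i) @^-1` [set v ord0 i]).
  apply/seteqP; split => [t xt i _ /=|t xt]; [by rewrite xt|apply/rowP => i].
  exact: (xt i I).
apply: fin_bigcap_measurable => // i _.
by rewrite -[_ @^-1` _]setTI; apply: mx => //; exact: measurable_set1.
Qed.

Variable F : seq 'rV[R]_d.
Hypothesis xF : forall t, x t \in F.

Lemma bigsetU_fibers : \big[setU/set0]_(v <- F) [set t | x t = v] = setT.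
Proof.
apply/seteqP; split => // t _; rewrite -bigcup_seq; exists (x t) => //.
exact: xF.
Qed.

(** The preimage splits over the finitely many fibres of [x], and on the fibre over [v] the function
    is [h v]. This handles an oracle queried at a random point. *)
Lemma measurable_finite_range (h : 'rV[R]_d -> T -> R) :
  (forall v, measurable_fun setT (h v)) ->
  measurable_fun setT (fun t => h (x t) t).
Proof.
move=> mh _ B mB; rewrite setTI.
have -> : (fun t => h (x t) t) @^-1` B =
    \big[setU/set0]_(v <- F) ([set t | x t = v] `&` (h v @^-1` B)).
  rewrite -bigcup_seq; apply/seteqP; split => [t Bt|t [v _ [/= <-]]//].
  by exists (x t) => //; exact: xF.
apply: bigsetU_measurable => v _; apply: measurableI.
  exact: measurable_fiber.
by rewrite -[_ @^-1` _]setTI; exact: mh.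
Qed.

End FiniteRange.

Lemma measurable_fun_sgr (R : realType) (dT : measure_display)
    (T : measurableType dT) (h : T -> R) :
  measurable_fun setT h -> measurable_fun setT (fun t => Num.sg (h t)).
Proof.
move=> mh.
have -> : (fun t => Num.sg (h t)) =
    (fun t => if 0 < h t then 1 else if h t < 0 then -1 else 0).
  by apply/funext => t; case: sgrP.
by apply: measurable_fun_ifT => //;
  [|apply: measurable_fun_ifT => //]; exact: measurable_fun_ltr.
Qed.

(** * Finite range and measurability of the Signum state *)

Section SignumMeasurable.
Variables (R : realType) (d : nat) (dO : measure_display)
  (Omega : measurableType dO) (G : 'rV[R]_d -> Omega -> 'rV[R]_d)
  (beta delta : R) (C : nat) (x0 : 'rV[R]_d).

Lemma sgnv_in (v : 'rV[R]_d) : sgnv v \in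
  codom (fun s : {ffun 'I_d -> 'I_3} => \row_i ((s i)%:R - 1 : R)).
Proof.
(* The two booleans add up to 0, 1 or 2 for a negative, zero or positive entry, which is the sign
   plus one. *)
pose s := [ffun i : 'I_d => inord ((0 <= v ord0 i)%R + (0 < v ord0 i)%R)%N : 'I_3].
apply/codomP; exists s; apply/rowP => i; rewrite !mxE ffunE inordK; last first.
  by case: (_ <= _); case: (_ < _).
by case: sgrP => _ /=; rewrite ?subrr ?sub0r// addrK.
Qed.

(** Step sizes are deterministic and directions are sign vectors, so each step multiplies the number
    of reachable points by at most [3 ^ d]. The list is chosen before [w]; being duplicate-free, it
    indexes disjoint fibres. *)
Lemma signum_iter_range k : exists F : seq 'rV[R]_d,
  uniq F /\ forall w, signum_iter G beta delta C x0 w k \in F.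
Proof.
elim: k => [|k [F [_ IH]]].
  by exists [:: x0]; split => // w; rewrite /signum_iter mem_head.
pose S := codom (fun s : {ffun 'I_d -> 'I_3} => \row_i ((s i)%:R - 1 : R)).
exists (undup [seq u - (delta / Num.sqrt k.+1%:R) *: s | u <- F, s <- S]).
split=> [|w]; first exact: undup_uniq.
rewrite mem_undup; apply: allpairs_f; first exact: IH.
by case: ifP => _; exact: sgnv_in.
Qed.

Variables (dT : measure_display) (T : measurableType dT)
  (w : T -> nat -> nat -> Omega) (n : nat).
Hypothesis mG : forall v i, measurable_fun setT (fun om => G v om ord0 i).
Hypothesis mw : forall k j, (k < n)%N ->
  measurable_fun setT (fun t => w t k j).

Let state k t := signum_state G beta delta C x0 (w t) k.

(** The measurable structure of [T] is left free and noise is measurable only before step [n], so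
    the lemma applies both to the whole sample space and to the sigma-algebra of the past. *)
Lemma measurable_signum_state k : (k <= n)%N ->
  (forall i, measurable_fun setT (fun t => (state k t).1 ord0 i)) /\
  (forall i, measurable_fun setT (fun t => (state k t).2 ord0 i)).
Proof.
elim: k => [_|k IH kn]; first by split=> i; exact: measurable_cst.
have [mx mm] := IH (ltnW kn).
have [F [_ xF]] := signum_iter_range k.
pose gt t := minibatch G (w t) (state k t).1 k.
have mgt i : measurable_fun setT (fun t => gt t ord0 i).
  have xF' t : (state k t).1 \in F by exact: xF.
  apply: (measurable_finite_range mx xF'
    (h := fun v t => minibatch G (w t) v k ord0 i)) => v.
  rewrite (_ : (fun t => _) =
      fun t => k.+1%:R^-1 * \sum_(j < k.+1) G v (w t k j) ord0 i); last first.
    by apply/funext => t; rewrite mxE summxE.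
  apply: measurable_funM => //; apply: measurable_sum => j.
  by apply: (measurableT_comp (mG v i)); exact: mw.
have mm' i : measurable_fun setT (fun t => (state k.+1 t).2 ord0 i).
  rewrite (_ : (fun t => _) =
      fun t => beta * (state k t).2 ord0 i + (1 - beta) * gt t ord0 i).
    by apply: measurable_funD; apply: measurable_funM.
  by apply/funext => t; rewrite mxE; congr (_ + _); rewrite mxE.
split=> // i.
pose mt t := (1 - beta ^+ k.+1)^-1 *: (state k.+1 t).2.
rewrite (_ : (fun t => _) = fun t => (state k t).1 ord0 i
   - delta / Num.sqrt k.+1%:R *
     Num.sg (if (k < C)%N then gt t ord0 i else mt t ord0 i)); last first.
  apply/funext => t; rewrite mxE; congr (_ + _); rewrite mxE; congr (- _).
  by rewrite mxE; congr (_ * _); case: ifP => _; rewrite mxE.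
apply: measurable_funB => //; apply: measurable_funM => //.
apply: measurable_fun_sgr; case: (k < C)%N; first exact: mgt.
rewrite (_ : (fun t => _) =
    fun t => (1 - beta ^+ k.+1)^-1 * (state k.+1 t).2 ord0 i).
  exact: measurable_funM.
by apply/funext => t; rewrite mxE.
Qed.

End SignumMeasurable.

(** * Independence of the past and the current mini-batch *)

Section Independence.
Context (R : realType) (dT dO : measure_display) (T : measurableType dT)
  (O : measurableType dO) (P : probability T R).

(** A pi-lambda argument: the finite measures sending [A] to [P (A]&[E)] and to [P A * P E] have
    equal total mass and agree on the pi-system [H], hence on the sigma-algebra it generates. *)
Lemma indep_g_sigma_algebra (H : set (set T)) (E : set T) :
  H `<=` measurable -> setI_closed H -> measurable E ->
  (forall A, H A -> P (A `&` E) = P A * P E)%E ->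
  forall A, <<s H >> A -> P (A `&` E) = (P A * P E)%E.
Proof.
move=> Hm HI mE HE A HA.
have PE0 : 0 <= fine (P E) by exact: fine_ge0.
pose m2 := mscale (NngNum PE0) P.
have m2E B : m2 B = (P B * P E)%E.
  by rewrite /m2 /mscale/= fineK ?fin_num_measure// muleC.
have HT : [set X | H X /\ X `<=` setT] = H.
  by apply/seteqP; split => [X []|X].
rewrite -m2E -/(mrestr P mE A).
apply: (g_sigma_algebra_measure_unique_trace H setT) => //; rewrite ?HT//.
- by rewrite [RHS]m2E probability_setT mul1e /= /mrestr setTI.
- by move=> B HB; rewrite [RHS]m2E /= /mrestr HE.
- by rewrite /= /mrestr setTI ltey_eq fin_num_measure.
Qed.

Variable xi : nat * nat -> T -> O.
Hypothesis mxi : forall p, measurable_fun setT (xi p).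
Hypothesis indep : mutually_independent P xi.

(** Cylinder events of the calls made before step [n], the first index being the step. Finite
    intersections, not single preimages, make the family a pi-system. *)
Definition past_rect (n : nat) : set (set T) :=
  [set A | exists (s : seq (nat * nat)) (B : nat * nat -> set O),
    [/\ forall p, p \in s -> (p.1 < n)%N, forall p, measurable (B p) &
     A = \bigcap_(p in [set p | p \in s]) xi p @^-1` B p]].

Lemma past_rect_preimage n p (B : set O) : (p.1 < n)%N -> measurable B ->
  past_rect n (xi p @^-1` B).
Proof.
move=> pn mB; exists [:: p], (fun=> B); split => //.
  by move=> q; rewrite inE => /eqP ->.
apply/seteqP; split => [t Bt q|t]; first by rewrite /= inE => /eqP ->.
by apply => /=; rewrite mem_head.
Qed.

Lemma measurable_past_rect n : past_rect n `<=` measurable.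
Proof.
move=> _ [s [B [_ mB ->]]]; apply: fin_bigcap_measurable => // p _.
by rewrite -[_ @^-1` _]setTI; exact: mxi.
Qed.

Lemma past_rectI n : setI_closed (past_rect n).
Proof.
move=> _ _ [s1 [B1 [s1n mB1 ->]]] [s2 [B2 [s2n mB2 ->]]].
(* The two lists may overlap, so a shared call receives both constraints, and [setT] stands for an
   absent one. *)
exists (s1 ++ s2), (fun p => (if p \in s1 then B1 p else setT) `&`
  (if p \in s2 then B2 p else setT)); split.
- by move=> p; rewrite mem_cat => /orP[/s1n|/s2n].
- by move=> p; apply: measurableI; case: ifP.
apply/seteqP; split => [t [t1 t2] p _|t tp].
  by split; case: ifP => // ps; [exact: t1|exact: t2].
split=> p /= ps; have [|] := tp p; rewrite /= ?mem_cat ?ps ?orbT//.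
Qed.

(** Joint independence of the past from two distinct later calls; pairs suffice because a squared
    sum involves only products of two terms. *)
Lemma indep_past n p q (A : set T) (B1 B2 : set O) :
  (n <= p.1)%N -> (n <= q.1)%N -> p != q -> measurable B1 -> measurable B2 ->
  <<s past_rect n >> A ->
  P (A `&` (xi p @^-1` B1 `&` xi q @^-1` B2)) =
  (P A * (P (xi p @^-1` B1) * P (xi q @^-1` B2)))%E.
Proof.
move=> np nq pq mB1 mB2 HA.
have mpre r B : measurable B -> measurable (xi r @^-1` B).
  by move=> mB; rewrite -[_ @^-1` _]setTI; exact: mxi.
(* Neither [p] nor [q] can lie in a list of past calls, so overriding [B] there leaves the past
   constraints intact and mutual independence applies to [p :: q :: s]. *)
pose B' B r := if r == p then B1 else if r == q then B2 else B r.
have mB' (B : nat * nat -> set O) :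
    (forall r, measurable (B r)) -> forall r, measurable (B' B r).
  by move=> mB r; rewrite /B'; case: ifP => // _; case: ifP.
have PE s (B : nat * nat -> set O) : uniq s ->
    (forall r, r \in s -> (r.1 < n)%N) -> (forall r, measurable (B r)) ->
  P ((\bigcap_(r in [set r | r \in s]) xi r @^-1` B r) `&`
     (xi p @^-1` B1 `&` xi q @^-1` B2)) =
  ((\prod_(r <- s) P (xi r @^-1` B r)) *
     (P (xi p @^-1` B1) * P (xi q @^-1` B2)))%E.
  move=> us sn mB.
  have ps : p \notin s by apply/negP => /sn; rewrite ltnNge np.
  have qs : q \notin s by apply/negP => /sn; rewrite ltnNge nq.
  have B's r : r \in s -> B' B r = B r.
    move=> rs; rewrite /B'.
    rewrite (negbTE (memPn ps _ rs)) (negbTE (memPn qs _ rs))//.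
  have B'p : B' B p = B1 by rewrite /B' eqxx.
  have B'q : B' B q = B2 by rewrite /B' eq_sym (negbTE pq) eqxx.
  have -> : (\prod_(r <- s) P (xi r @^-1` B r) =
      \prod_(r <- s) P (xi r @^-1` B' B r))%E.
    by apply: eq_big_seq => r /B's ->.
  have := indep (s := p :: q :: s) _ (mB' _ mB).
  rewrite !big_cons B'p B'q /= inE negb_or pq ps qs us => /(_ erefl).
  rewrite muleA [RHS]muleC => <-; congr (P _).
  apply/seteqP; split => [t [ts [tp tq]] r /=|t tA].
    rewrite !inE => /or3P[/eqP ->|/eqP ->|rs]; rewrite ?B'p ?B'q ?B's//.
    exact: ts.
  split.
    by move=> r /= rs; rewrite -(B's r rs); apply: tA; rewrite /= !inE rs !orbT.
  by split; [rewrite -B'p|rewrite -B'q]; apply: tA; rewrite /= !inE eqxx ?orbT.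
(* With the empty list of past calls, the product rule is the independence of [p] and [q]
   themselves. *)
have PE0 : P (xi p @^-1` B1 `&` xi q @^-1` B2) =
    (P (xi p @^-1` B1) * P (xi q @^-1` B2))%E.
  have := PE [::] (fun=> setT); rewrite big_nil mul1e => <- //.
  congr (P _).
  by rewrite (_ : \bigcap_(_ in _) _ = setT) ?setTI//; apply/seteqP; split.
rewrite -PE0; apply: (indep_g_sigma_algebra _ _ _ _ HA).
- exact: measurable_past_rect.
- exact: past_rectI.
- by apply: measurableI; exact: mpre.
move=> _ [s [B [sn mB ->]]]; rewrite PE0.
(* Mutual independence is stated for duplicate-free lists; removing repetitions does not change the
   intersection. *)
have := @PE (undup s) B (undup_uniq s).
rewrite (_ : [set r | r \in undup s] = [set r | r \in s]); last first.
  by apply/seteqP; split => r /=; rewrite mem_undup.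
move=> -> //; last by move=> r; rewrite mem_undup; exact: sn.
congr (_ * _)%E.
have := indep (undup_uniq s) mB.
rewrite (_ : [set r | r \in undup s] = [set r | r \in s])//.
by apply/seteqP; split => r /=; rewrite mem_undup.
Qed.

End Independence.

(** * Integrals over an event independent of the integrand *)

Section IndependentIntegrals.
Context (R : realType) (dT dO : measure_display) (T : measurableType dT)
  (O : measurableType dO) (P : probability T R) (mu : probability O R).
Variables (A : set T) (mA : measurable A).
Let Q := mrestr P mA.

(** The complement of [A] is [Q]-null. Passing to [Q] turns an integral over [A] into one over the
    whole space, where change of variables and Fubini apply. *)
Lemma ge0_integral_mrestr (f : T -> \bar R) :
  measurable_fun setT f -> (forall t, 0 <= f t)%E ->
  (\int[Q]_t f t = \int[P]_(t in A) f t)%E.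
Proof.
move=> mf f0.
rewrite (ge0_negligible_integral (N := ~` A))//; last 2 first.
- exact: measurableC.
- by rewrite /= /Q /mrestr setICl measure0.
rewrite setTD setCK; apply: eq_measure_integral => S mS SA.
by rewrite /= /Q /mrestr setIidl.
Qed.

Lemma integrable_mrestr (f : T -> \bar R) : measurable_fun setT f ->
  P.-integrable A f -> Q.-integrable setT f.
Proof.
move=> mf /integrableP[_ fi]; apply/integrableP; split => //.
by rewrite ge0_integral_mrestr//; exact: measurableT_comp.
Qed.

Lemma integral_mrestr (f : T -> \bar R) : measurable_fun setT f ->
  P.-integrable A f -> (\int[Q]_t f t = \int[P]_(t in A) f t)%E.
Proof.
move=> mf fi; rewrite (negligible_integral (N := ~` A))//; last 3 first.
- exact: measurableC.
- exact: integrable_mrestr.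
- by rewrite /= /Q /mrestr setICl measure0.
rewrite setTD setCK; apply: eq_measure_integral => S mS SA.
by rewrite /= /Q /mrestr setIidl.
Qed.

Let PA0 : 0 <= fine (P A). Proof. exact: fine_ge0. Qed.
(** The law under [Q] of a variable of law [mu] independent of [A]. Multiplying by [P A], instead of
    conditioning on [A], also covers null events. *)
Let muA := mscale (NngNum PA0) mu.

Let muAE B : muA B = (P A * mu B)%E.
Proof. by rewrite /muA /mscale/= fineK ?fin_num_measure. Qed.

Lemma ge0_integral_indep (X : T -> O) (h : O -> \bar R) :
  measurable_fun setT X ->
  (forall B, measurable B -> P (A `&` X @^-1` B) = P A * mu B)%E ->
  measurable_fun setT h -> (forall o, 0 <= h o)%E ->
  (\int[P]_(t in A) h (X t) = P A * \int[mu]_o h o)%E.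
Proof.
move=> mX XA mh h0.
have mhX : measurable_fun setT (h \o X) by exact: measurableT_comp.
rewrite -(ge0_integral_mrestr mhX)//; last by move=> t; exact: h0.
rewrite -[LHS](ge0_integral_pushforward mX Q (D := setT))//.
(* Packing [X] as a measurable function gives [pushforward Q X'] its measure structure. *)
pose X' : {mfun T >-> O} := HB.pack X (isMeasurableFun.Build _ _ _ _ _ mX).
rewrite (@eq_measure_integral _ _ _ _ muA (pushforward Q X')).
  by rewrite ge0_integral_mscale//= fineK ?fin_num_measure.
move=> B mB _; rewrite [RHS]muAE -XA//.
by rewrite /= /pushforward /Q /mrestr setIC.
Qed.

Variables (X1 X2 : T -> O) (y : O -> R).
Hypothesis mX1 : measurable_fun setT X1.
Hypothesis mX2 : measurable_fun setT X2.
Hypothesis X12 : forall B1 B2, measurable B1 -> measurable B2 ->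
  P (A `&` (X1 @^-1` B1 `&` X2 @^-1` B2)) = (P A * (mu B1 * mu B2))%E.
Hypothesis iy : mu.-integrable setT (EFin \o y).
Hypothesis y2 : (\int[mu]_o (y o ^+ 2)%:E < +oo)%E.

Let my : measurable_fun setT y.
Proof. by apply/measurable_EFinP; exact: measurable_int iy. Qed.

Let X1A B : measurable B -> P (A `&` X1 @^-1` B) = (P A * mu B)%E.
Proof.
move=> mB; have := X12 mB measurableT.
by rewrite preimage_setT setIT probability_setT mule1.
Qed.

Let X2A B : measurable B -> P (A `&` X2 @^-1` B) = (P A * mu B)%E.
Proof.
move=> mB; have := X12 measurableT mB.
by rewrite preimage_setT setTI probability_setT mul1e.
Qed.

Let integrable_sqr X : measurable_fun setT X ->
  (forall B, measurable B -> P (A `&` X @^-1` B) = P A * mu B)%E ->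
  P.-integrable A (fun t => (y (X t) ^+ 2)%:E).
Proof.
move=> mX XA; apply/integrableP; split.
  apply: measurable_funTS; apply/measurable_EFinP.
  by apply: measurable_funX; exact: measurableT_comp.
under eq_integral do rewrite gee0_abs ?lee_fin ?sqr_ge0//.
rewrite (ge0_integral_indep (h := fun o => (y o ^+ 2)%:E) mX XA) //.
- by rewrite lte_mul_pinfty// fin_num_measure.
- by apply/measurable_EFinP; exact: measurable_funX.
- by move=> o; rewrite lee_fin sqr_ge0.
Qed.

Let mF : measurable_fun setT (fun p : O * O => (y p.1 * y p.2)%:E).
Proof.
apply/measurable_EFinP; apply: measurable_funM.
  exact: (measurableT_comp my).
exact: (measurableT_comp my).
Qed.

Let mPhi : measurable_fun setT (fun t => (X1 t, X2 t)).
Proof. exact: measurable_fun_pair. Qed.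

(** Domination by the sum of the two squares. *)
Lemma integrable_indep_mul : P.-integrable A (fun t => (y (X1 t) * y (X2 t))%:E).
Proof.
apply: (le_integrable mA) (integrableD mA (integrable_sqr mX1 X1A)
  (integrable_sqr mX2 X2A)).
  apply: measurable_funTS.
  exact: (measurableT_comp mF mPhi).
move=> t _; rewrite /= lee_fin; move: (y _) (y _) => a b.
rewrite [leRHS]ger0_norm ?addr_ge0 ?sqr_ge0// ler_norml.
have := sqr_ge0 (a + b); have := sqr_ge0 (a - b).
by move=> *; apply/andP; split; nra.
Qed.

Hypothesis y0 : (\int[mu]_o (y o)%:E = 0)%E.

(** On [A] the pair has the product law [muA \x mu], so by Fubini the inner integral is a multiple
    of the mean of [y], which is zero. *)
Lemma integral_indep_mul : (\int[P]_(t in A) (y (X1 t) * y (X2 t))%:E = 0)%E.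
Proof.
have mFP := measurableT_comp mF mPhi.
have FQ := integrable_mrestr mFP integrable_indep_mul.
rewrite -(integral_mrestr mFP integrable_indep_mul).
have := integral_pushforward mPhi (D := setT) mF FQ measurableT.
rewrite preimage_setT => <-.
pose Phi : {mfun T >-> (O * O)%type} := HB.pack (fun t => (X1 t, X2 t))
  (isMeasurableFun.Build _ _ _ _ _ mPhi).
(* By uniqueness of the product measure it is enough to compare rectangles, which is [X12]. *)
have pushE S : measurable S -> pushforward Q Phi S = (muA \x mu)%E S.
  move=> mS; apply/esym.
  have H := product_measure_unique (m1 := muA) (m2 := mu)
    (m' := pushforward Q Phi).
  apply: H => // B1 B2 mB1 mB2.
  rewrite [X in _ = (X * _)%E](muAE B1) -muleA -X12//.
  by rewrite /= /pushforward /Q /mrestr setIC.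
have iF : (muA \x mu)%E.-integrable setT (fun p : O * O => (y p.1 * y p.2)%:E).
  have /integrableP[_ +] := integrable_pushforward mPhi mF FQ measurableT.
  move=> H; apply/integrableP; split => //.
  rewrite (eq_measure_integral (pushforward Q Phi)); first exact: H.
  by move=> S mS _; exact/esym/pushE.
rewrite (@eq_measure_integral _ _ _ _ (muA \x mu)%E (pushforward Q Phi)); last first.
  by move=> S mS _; exact: pushE.
rewrite -integral12_prod_meas1//= /fubini_F/=.
apply: integral0_eq => o _.
under eq_integral do rewrite EFinM.
by rewrite integralZl// y0 mule0.
Qed.

End IndependentIntegrals.

(** Additivity of the variance, localised to an event: in the expanded square the off-diagonal terms
    vanish and the diagonal ones are equal. *)
Lemma integral_indep_sum_sqr (R : realType) (dT dO : measure_display)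
    (T : measurableType dT) (O : measurableType dO) (P : probability T R)
    (mu : probability O R) (A : set T) (X : nat -> T -> O) (y : O -> R)
    (n : nat) :
  measurable A -> (forall j, measurable_fun setT (X j)) ->
  (forall j l B1 B2, j != l -> measurable B1 -> measurable B2 ->
    P (A `&` (X j @^-1` B1 `&` X l @^-1` B2)) = P A * (mu B1 * mu B2))%E ->
  mu.-integrable setT (EFin \o y) ->
  (\int[mu]_o (y o ^+ 2)%:E < +oo)%E -> (\int[mu]_o (y o)%:E = 0)%E ->
  (\int[P]_(t in A) ((\sum_(j < n) y (X j t)) ^+ 2)%:E =
   n%:R%:E * (P A * \int[mu]_o (y o ^+ 2)%:E))%E.
Proof.
move=> mA mX XX iy y2 y0.
have my : measurable_fun setT y.
  by apply/measurable_EFinP; exact: measurable_int iy.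
have XA j B : measurable B -> P (A `&` X j @^-1` B) = (P A * mu B)%E.
  (* Any index other than [j] would do as partner; its constraint is trivial. *)
  move=> mB; have := @XX j j.+1 B setT.
  rewrite preimage_setT setIT probability_setT mule1; apply => //.
  by rewrite neq_ltn ltnSn.
have msqr : measurable_fun setT (fun o => (y o ^+ 2)%:E).
  by apply/measurable_EFinP; exact: measurable_funX.
have diag j : (\int[P]_(t in A) (y (X j t) * y (X j t))%:E =
    P A * \int[mu]_o (y o ^+ 2)%:E)%E.
  under eq_integral do rewrite -expr2.
  apply: (ge0_integral_indep mA (mX j) (XA j) msqr) => o.
  by rewrite lee_fin sqr_ge0.
have int_diag j : P.-integrable A (fun t => (y (X j t) * y (X j t))%:E).
  apply/integrableP; split.
    apply/measurable_EFinP; apply: measurable_funTS.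
    by apply: measurable_funM; exact: measurableT_comp.
  under eq_integral do rewrite gee0_abs ?lee_fin -?expr2 ?sqr_ge0// expr2.
  by rewrite diag lte_mul_pinfty// fin_num_measure.
have int_mul j l : P.-integrable A (fun t => (y (X j t) * y (X l t))%:E).
  have [<-//|jl] := eqVneq j l.
  by apply: (integrable_indep_mul (mu := mu)) => // *; exact: XX.
under eq_integral => t _.
  rewrite expr2 big_distrlr/= pair_big/= -sumEFin; over.
rewrite (integral_sum mA (f := fun p : 'I_n * 'I_n => fun t =>
  (y (X p.1 t) * y (X p.2 t))%:E))//=.
rewrite -(pair_big xpredT xpredT (fun i j : 'I_n =>
  \int[P]_(t in A) (y (X i t) * y (X j t))%:E)%E)/=.
(* The factor 1 lets the common value be pulled out, leaving a sum of ones equal to [n]. *)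
transitivity (\sum_(i < n) 1 * (P A * \int[mu]_o (y o ^+ 2)%:E))%E.
  apply: eq_bigr => i _; rewrite (bigD1 i)//= big1 ?adde0 ?diag ?mul1e// => j ji.
  by apply: (integral_indep_mul mA (mu := mu)) => // *; apply: XX; rewrite // eq_sym.
rewrite -ge0_sume_distrl//.
by rewrite sumEFin sumr_const card_ord.
Qed.

(** * Expected noise and gradient bounds *)

Lemma integral_abs_le_sqrt_n (R : realType) (dT : measure_display)
    (T : measurableType dT) (P : probability T R) (z : T -> R) (s : R) (n : nat) :
  measurable_fun setT z -> 0 <= s -> (0 < n)%N ->
  (\int[P]_t (z t ^+ 2)%:E <= (s ^+ 2 / n%:R)%:E)%E ->
  (\int[P]_t (`|z t|)%:E <= (s / Num.sqrt n%:R)%:E)%E.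
Proof.
move=> mz s0 n0 z2.
have q0 : 0 < Num.sqrt n%:R :> R by rewrite sqrtr_gt0 ltr0n.
have qq : Num.sqrt n%:R ^+ 2 = n%:R :> R by rewrite sqr_sqrtr.
set q := Num.sqrt n%:R in q0 qq *.
apply/lee_addgt0Pr => e e0; rewrite -EFinD.
(* Chosen so that [r / q] is exactly the target [s / q + e], with [r] positive even for [s = 0]. *)
pose r := s + e * q.
have r0 : 0 < r by rewrite ltr_wpDl// mulr_gt0.
(* AM-GM with a free weight, so that [s = 0] needs no separate treatment *)
have amgm t : `|z t| <= q / (2 * r) * z t ^+ 2 + r / (2 * q).
  rewrite -subr_ge0.
  have -> : q / (2 * r) * z t ^+ 2 + r / (2 * q) - `|z t| =
      q / (2 * r) * (`|z t| - r / q) ^+ 2.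
    by rewrite sqrrB real_normK ?num_real//; field; rewrite !gt_eqF.
  by rewrite mulr_ge0 ?sqr_ge0// divr_ge0 ?mulr_ge0// ltW.
have mz2 : measurable_fun setT (fun t => (z t ^+ 2)%:E).
  by apply/measurable_EFinP; exact: measurable_funX.
have c0 : 0 <= q / (2 * r) by rewrite divr_ge0 ?mulr_ge0// ltW.
have c1 : 0 <= r / (2 * q) by rewrite divr_ge0 ?mulr_ge0// ltW.
apply: (@le_trans _ _
    (\int[P]_t ((q / (2 * r))%:E * (z t ^+ 2)%:E + (r / (2 * q))%:E))%E).
  apply: ge0_le_integral => //.
  - by apply/measurable_EFinP; exact: measurableT_comp.
  - by apply: emeasurable_funD => //; exact: measurable_funeM.
  - by move=> t _; rewrite -EFinM -EFinD lee_fin.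
rewrite ge0_integralD//; last 2 first.
- by move=> t _; rewrite mule_ge0 ?lee_fin ?sqr_ge0.
- exact: measurable_funeM.
rewrite ge0_integralZl_EFin//; last by move=> t _; rewrite lee_fin sqr_ge0.
rewrite integral_cst//= probability_setT mule1.
apply: (@le_trans _ _ ((q / (2 * r))%:E * (s ^+ 2 / n%:R)%:E + (r / (2 * q))%:E)%E).
  by rewrite leeD2r// lee_wpmul2l ?lee_fin.
rewrite -EFinM -EFinD lee_fin -qq.
have -> : s / q + e = r / q by rewrite /r; field; rewrite gt_eqF.
have -> : q / (2 * r) * (s ^+ 2 / q ^+ 2) + r / (2 * q) =
   r / q - (r ^+ 2 - s ^+ 2) / (2 * r * q).
  by field; rewrite !gt_eqF.
rewrite gerBl divr_ge0//; last by rewrite !mulr_ge0// ltW.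
rewrite subr_ge0 ler_pXn2r// ?nnegrE ?(ltW r0)//.
by rewrite lerDl mulr_ge0// ltW.
Qed.

(** * Mean size of the mini-batch noise at a random iterate *)

Section ExpectedNoise.
Variables (R : realType) (d : nat) (g : 'rV[R]_d -> 'rV[R]_d)
  (sigma : 'I_d -> R) (beta delta : R) (C : nat) (x0 : 'rV[R]_d)
  (dO : measure_display) (Omega : measurableType dO) (mu : probability Omega R)
  (G : 'rV[R]_d -> Omega -> 'rV[R]_d)
  (dT : measure_display) (T : measurableType dT) (P : probability T R)
  (xi : nat -> nat -> T -> Omega).
Hypothesis sigma_ge0 : forall i, 0 <= sigma i.
Hypothesis iG : forall v i, mu.-integrable setT (fun om => (G v om ord0 i)%:E).
Hypothesis EG : forall v i,
  (\int[mu]_om (G v om ord0 i)%:E = (g v ord0 i)%:E)%E.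
Hypothesis VG : forall v i,
  (\int[mu]_om ((G v om ord0 i - g v ord0 i) ^+ 2)%:E <= (sigma i ^+ 2)%:E)%E.
Hypothesis mxi : forall k j, measurable_fun setT (xi k j).
Hypothesis xi_mu : forall k j (B : set Omega),
  measurable B -> P (xi k j @^-1` B) = mu B.
Hypothesis indep :
  mutually_independent P (fun p : nat * nat => xi p.1 p.2).

Let w t k j := xi k j t.
Let x k t := signum_iter G beta delta C x0 (w t) k.
Let noise k t := minibatch G (w t) (x k t) k - g (x k t).

Let mG v i : measurable_fun setT (fun om => G v om ord0 i).
Proof. by apply/measurable_EFinP; exact: measurable_int (iG v i). Qed.

Lemma measurable_signum_iter k i : measurable_fun setT (fun t => x k t ord0 i).
Proof.
by have [/(_ i)] := measurable_signum_state beta delta C x0 mG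
  (w := w) (n := k) (fun k j _ => mxi k j) (leqnn k).
Qed.

(** The sample space is given the sigma-algebra of the past, for which the noise of earlier steps is
    measurable by construction. *)
Lemma past_signum_iter k v :
  <<s past_rect (fun p : nat * nat => xi p.1 p.2) k >> [set t | x k t = v].
Proof.
pose S := past_rect (fun p : nat * nat => xi p.1 p.2) k.
apply: (measurable_fiber (T := g_sigma_algebraType S)) => i.
have mw l j : (l < k)%N ->
    measurable_fun setT (fun t : g_sigma_algebraType S => w t l j).
  move=> lk _ B mB; rewrite setTI; apply: sub_gen_smallest.
  exact: (past_rect_preimage (fun p : nat * nat => xi p.1 p.2) (p := (l, j))).
by have [/(_ i)] := measurable_signum_state beta delta C x0 mG mw (leqnn k).
Qed.

Lemma measurable_signum_fun k (h : 'rV[R]_d -> R) :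
  measurable_fun setT (fun t => h (x k t)).
Proof.
have [F [_ xF]] := signum_iter_range G beta delta C x0 k.
apply: (measurable_finite_range (@measurable_signum_iter k)
  (fun t => xF (w t)) (h := fun v _ => h v)) => v.
exact: measurable_cst.
Qed.

Lemma measurable_noise k i : measurable_fun setT (fun t => noise k t ord0 i).
Proof.
have [F [_ xF]] := signum_iter_range G beta delta C x0 k.
apply: (measurable_finite_range (@measurable_signum_iter k)
  (fun t => xF (w t))
  (h := fun v t => (minibatch G (w t) v k - g v) ord0 i)) => v.
rewrite (_ : (fun t => _) =
  fun t => k.+1%:R^-1 * (\sum_(j < k.+1) G v (w t k j) ord0 i) - g v ord0 i).
  apply: measurable_funB => //; apply: measurable_funM => //.
  by apply: measurable_sum => j; apply: (measurableT_comp (mG v i)); exact: mxi.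
by apply/funext => t; rewrite mxE [X in _ + X]mxE mxE summxE.
Qed.

(** On each fibre of [x k] the query point is constant and the fibre is a past event, so the
    variance of an average of [k.+1] independent calls appears with weight [P (A v)]; these weights
    add up to 1. *)
Lemma noise_second_moment k i :
  (\int[P]_t (noise k t ord0 i ^+ 2)%:E <= (sigma i ^+ 2 / k.+1%:R)%:E)%E.
Proof.
have [F [uF xF]] := signum_iter_range G beta delta C x0 k.
pose A v := [set t | x k t = v].
have mA v : measurable (A v) by apply: measurable_fiber; exact: measurable_signum_iter.
have tA : trivIset [set` F] A.
  by move=> u v _ _ [t [<- <-]].
have AT : \big[setU/set0]_(v <- F) A v = setT.
  exact: (bigsetU_fibers (fun t => xF (w t))).
have split (h : T -> \bar R) : measurable_fun setT h -> (forall t, 0 <= h t)%E ->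
    (\int[P]_t h t = \sum_(v <- F) \int[P]_(t in A v) h t)%E.
  by move=> mh h0; rewrite -[in LHS]AT ge0_integral_bigsetU// AT.
have mn2 : measurable_fun setT (fun t => (noise k t ord0 i ^+ 2)%:E).
  by apply/measurable_EFinP; apply: measurable_funX; exact: measurable_noise.
have n0 : 0 < k.+1%:R :> R by rewrite ltr0n.
rewrite split//; last by move=> t; rewrite lee_fin sqr_ge0.
have s0 : 0 <= sigma i ^+ 2 / k.+1%:R by rewrite divr_ge0 ?sqr_ge0 // ltW.
(* The constant bound is split over the same fibres, so the comparison can be made fibre by
   fibre. *)
apply: (@le_trans _ _
    (\sum_(v <- F) \int[P]_(t in A v) (sigma i ^+ 2 / k.+1%:R)%:E)%E); last first.
  by rewrite -split// integral_cst//= probability_setT mule1.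
apply: lee_sum => v _; rewrite integral_cst//.
pose y om := G v om ord0 i - g v ord0 i.
have iy : mu.-integrable setT (EFin \o y).
  rewrite (_ : _ \o _ = (fun om => (G v om ord0 i)%:E) \- cst (g v ord0 i)%:E)%E//.
  by apply: integrableB => //; exact: finite_measure_integrable_cst.
have y0 : (\int[mu]_om (y om)%:E = 0)%E.
  under eq_integral do rewrite /y EFinB.
  rewrite integralB//; last exact: finite_measure_integrable_cst.
  by rewrite EG integral_cst//= probability_setT mule1 subee.
have y2 : (\int[mu]_om (y om ^+ 2)%:E < +oo)%E.
  by rewrite (le_lt_trans (VG v i))// ltry.
have XX j l B1 B2 : j != l -> measurable B1 -> measurable B2 ->
  (P (A v `&` (xi k j @^-1` B1 `&` xi k l @^-1` B2)) =
   P (A v) * (mu B1 * mu B2))%E.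
  move=> jl mB1 mB2; rewrite -(xi_mu k j mB1) -(xi_mu k l mB2).
  have H := indep_past (fun p => mxi p.1 p.2) indep (n := k) (p := (k, j))
    (q := (k, l)).
  by apply: H => //; [rewrite xpair_eqE eqxx|exact: past_signum_iter].
have noiseE t : t \in A v -> (noise k t ord0 i ^+ 2)%:E =
    (((k.+1%:R ^- 1) ^+ 2)%:E * ((\sum_(j < k.+1) y (xi k j t)) ^+ 2)%:E)%E.
  rewrite inE => /= xv; rewrite -EFinM -exprMn; congr (_ ^+ 2)%:E.
  rewrite /noise xv mxE [X in _ + X]mxE mxE summxE /y sumrB mulrBr; congr (_ - _).
  by rewrite sumr_const card_ord -[X in _ * X]mulr_natl mulrA mulVf ?mul1r// gt_eqF.
rewrite (eq_integral _ _ noiseE) ge0_integralZl_EFin//; last 2 first.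
- by move=> t _; rewrite lee_fin sqr_ge0.
- apply: measurable_funTS; apply/measurable_EFinP; apply: measurable_funX.
  apply: measurable_sum => j; apply: measurableT_comp (mxi k j).
  by apply/measurable_EFinP; exact: measurable_int iy.
rewrite (integral_indep_sum_sqr (mu := mu))//.
rewrite muleA -EFinM expr2 -mulrA mulVf ?gt_eqF// mulr1 [leRHS]muleC muleCA.
rewrite lee_wpmul2l// mulrC EFinM lee_wpmul2l ?lee_fin ?invr_ge0// ?(ltW n0)//.
exact: VG.
Qed.

Lemma expected_norm1_noise k : (\int[P]_t (norm1 (noise k t))%:E <=
  ((\sum_(i < d) sigma i) * (Num.sqrt k.+1%:R)^-1)%:E)%E.
Proof.
under eq_integral do rewrite /norm1 -sumEFin.
rewrite ge0_integral_sum//; last first.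
  move=> i; apply/measurable_EFinP; apply: measurableT_comp => //.
  exact: measurable_noise.
rewrite mulr_suml -sumEFin; apply: lee_sum => i _.
apply: integral_abs_le_sqrt_n => //; first exact: measurable_noise.
exact: noise_second_moment.
Qed.

End ExpectedNoise.

(** The increment is controlled by [ln (1 + x) <= x] at [x = - n.+2%:R^-1]. *)
Lemma harmonic_le_ln (R : realType) (n : nat) :
  \sum_(k < n.+1) (k.+1%:R)^-1 <= 1 + ln n.+1%:R :> R.
Proof.
elim: n => [|n IH]; first by rewrite big_ord1 ln1 addr0 invr1.
rewrite big_ord_recr/= (le_trans (lerD IH (lexx _)))//.
have p1 : 0 < n.+1%:R :> R by rewrite ltr0n.
have p2 : 0 < n.+2%:R :> R by rewrite ltr0n.
have : ln (1 + - n.+2%:R^-1) <= - n.+2%:R^-1 :> R.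
  by apply: le_ln1Dx; rewrite ltrN2 invf_lt1// ltr1n.
have -> : 1 + - n.+2%:R^-1 = n.+1%:R / n.+2%:R :> R.
  by rewrite -[in n.+1%:R]natr1 [n.+2%:R]mulrSr; field; rewrite gt_eqF.
by rewrite ln_div ?posrE// lerNr opprB -addrA lerD2l -lerBrDl.
Qed.

(** * Expectation of the averaged gradient norm *)

Section ExpectedGradient.
Variables (R : realType) (d : nat) (f : 'rV[R]_d -> R) (fstar : R)
  (L sigma : 'I_d -> R) (beta delta : R) (C : nat) (x0 : 'rV[R]_d)
  (dO : measure_display) (Omega : measurableType dO) (mu : probability Omega R)
  (G : 'rV[R]_d -> Omega -> 'rV[R]_d)
  (dT : measure_display) (T : measurableType dT) (P : probability T R)
  (xi : nat -> nat -> T -> Omega).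
Hypothesis f_ge : forall x, fstar <= f x.
Hypothesis L_ge0 : forall i, 0 <= L i.
Hypothesis smooth : forall x y : 'rV[R]_d,
  `| f y - f x - \sum_(i < d) grad f x ord0 i * (y ord0 i - x ord0 i) |
  <= 2^-1 * \sum_(i < d) L i * (y ord0 i - x ord0 i) ^+ 2.
Hypothesis sigma_ge0 : forall i, 0 <= sigma i.
Hypothesis iG : forall v i, mu.-integrable setT (fun om => (G v om ord0 i)%:E).
Hypothesis EG : forall v i,
  (\int[mu]_om (G v om ord0 i)%:E = (grad f v ord0 i)%:E)%E.
Hypothesis VG : forall v i,
  (\int[mu]_om ((G v om ord0 i - grad f v ord0 i) ^+ 2)%:E
   <= (sigma i ^+ 2)%:E)%E.
Hypothesis mxi : forall k j, measurable_fun setT (xi k j).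
Hypothesis xi_mu : forall k j (B : set Omega),
  measurable B -> P (xi k j @^-1` B) = mu B.
Hypothesis indep :
  mutually_independent P (fun p : nat * nat => xi p.1 p.2).
Hypothesis beta01 : 0 < beta < 1.
Hypothesis delta_gt0 : 0 < delta.

Let w t k j := xi k j t.
Let x k t := signum_iter G beta delta C x0 (w t) k.
Let noise k t := minibatch G (w t) (x k t) k - grad f (x k t).
Let Lsum := \sum_(i < d) L i.
Let Ssum := \sum_(i < d) sigma i.
Let a k : R := (Num.sqrt k.+1%:R)^-1.

(** Bounded by a finite sum, since [x k] has finite range. *)
Lemma integrable_signum_fun k (h : 'rV[R]_d -> R) :
  P.-integrable setT (fun t => (h (x k t))%:E).
Proof.
have [F [uF xF]] := signum_iter_range G beta delta C x0 k.
apply: (le_integrable measurableT (g := cst (\sum_(v <- F) `|h v|)%:E)).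
- apply/measurable_EFinP; exact: (measurable_signum_fun _ _ _ _ iG mxi).
- move=> t _; rewrite lee_fin [leRHS]ger0_norm ?sumr_ge0//.
  by rewrite (bigD1_seq (x k t))//= ?lerDl ?sumr_ge0//; exact: xF.
- exact: finite_measure_integrable_cst.
Qed.

(** Divides the pathwise bound by its smallest weight [delta / sqrt K]. The expected noise
    contributes a second factor [a k], so noise and smoothness terms carry the same harmonic sum. *)
Lemma expected_norm1_signum_grad K : (C < K)%N ->
  (\int[P]_t ((K - C)%:R^-1 *
      \sum_(C <= k < K) norm1 (grad f (x k t)))%:E <=
   (Num.sqrt K%:R / (K - C)%:R *
     ((fine (\int[P]_t (f (x C t))%:E) - fstar) / delta
     + 2 / (1 - beta) ^+ 2 * (Ssum * \sum_(k < K) a k ^+ 2)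
     + (2^-1 + 6 / (1 - beta) ^+ 2) * delta * Lsum *
       \sum_(k < K) a k ^+ 2))%:E)%E.
Proof.
move=> CK; set r := Num.sqrt _ / _; set H := \sum_(k < K) a k ^+ 2.
have /andP[beta0 beta1] := beta01.
have b0 : 0 < 1 - beta by rewrite subr_gt0.
have K0 : 0 < K%:R :> R by rewrite ltr0n (leq_ltn_trans _ CK).
have KC0 : 0 < (K - C)%:R :> R by rewrite ltr0n subn_gt0.
have q0 : 0 < Num.sqrt K%:R :> R by rewrite sqrtr_gt0.
have r0 : 0 < r by rewrite divr_gt0.
have H0 : 0 <= H by apply: sumr_ge0 => k _; rewrite sqr_ge0.
have Lsum0 : 0 <= Lsum by exact: sumr_ge0.
have a0 k : 0 <= a k by rewrite invr_ge0 sqrtr_ge0.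
pose c1 := r / delta; pose c2 := r * (2 / (1 - beta) ^+ 2).
pose c3 := r * ((2^-1 + 6 / (1 - beta) ^+ 2) * delta * Lsum * H).
have c1_0 : 0 <= c1 by rewrite divr_ge0// ltW.
have c2_0 : 0 <= c2 by rewrite !mulr_ge0 ?invr_ge0 ?sqr_ge0// ltW.
have c3_0 : 0 <= c3.
  by rewrite /c3 !mulr_ge0 ?addr_ge0 ?mulr_ge0 ?invr_ge0 ?sqr_ge0// ltW.
have path t : (K - C)%:R^-1 * \sum_(C <= k < K) norm1 (grad f (x k t)) <=
    c1 * (f (x C t) - fstar) + c2 * (\sum_(k < K) a k * norm1 (noise k t)) + c3.
  have := sum_norm1_signum_grad G x0 (w t)
    L_ge0 smooth f_ge beta01 delta_gt0 (ltnW CK).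
  rewrite -/(H) => D.
  have lb : delta / Num.sqrt K%:R * \sum_(C <= k < K) norm1 (grad f (x k t)) <=
      \sum_(C <= k < K) delta * a k * norm1 (grad f (x k t)).
    rewrite mulr_sumr; apply: ler_sum_nat => k /andP[_ kK].
    rewrite ler_wpM2r ?norm1_ge0// ler_wpM2l ?(ltW delta_gt0)// /a.
    rewrite lef_pV2 ?posrE ?q0 ?sqrtr_gt0 ?ltr0n//.
    by rewrite ler_sqrt ?K0// ler_nat.
  have {}D := le_trans lb D.
  have -> : (K - C)%:R^-1 * \sum_(C <= k < K) norm1 (grad f (x k t)) =
      r / delta *
      (delta / Num.sqrt K%:R * \sum_(C <= k < K) norm1 (grad f (x k t))).
    by rewrite /r; field; rewrite !gt_eqF.
  apply: le_trans (ler_wpM2l c1_0 D) _.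
  rewrite le_eqVlt; apply/orP; left; apply/eqP.
  rewrite /c1 /c2 /c3 -/(H) /Lsum /noise /x.
  by field; rewrite !gt_eqF.
(* All three summands are nonnegative, which allows termwise integration. *)
pose U t := (c1%:E * (f (x C t) - fstar)%:E +
  c2%:E * (\sum_(k < K) (a k)%:E * (norm1 (noise k t))%:E) + c3%:E)%E.
have mf (h : 'rV[R]_d -> R) k : measurable_fun setT (fun t => (h (x k t))%:E).
  by apply/measurable_EFinP; exact: (measurable_signum_fun _ _ _ _ iG mxi).
have mnoise k : measurable_fun setT (fun t => (norm1 (noise k t))%:E).
  apply/measurable_EFinP; apply: measurable_sum => i.
  by apply: measurableT_comp => //; exact: (measurable_noise _ _ _ _ _ iG mxi).
have man k : measurable_fun setT (fun t => (a k)%:E * (norm1 (noise k t))%:E)%E.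
  exact: measurable_funeM.
have msum : measurable_fun setT
    (fun t => \sum_(k < K) (a k)%:E * (norm1 (noise k t))%:E)%E.
  exact: emeasurable_sum.
have an0 k t : (0 <= (a k)%:E * (norm1 (noise k t))%:E)%E.
  by rewrite mule_ge0 ?lee_fin ?norm1_ge0.
have sum0 t : (0 <= \sum_(k < K) (a k)%:E * (norm1 (noise k t))%:E)%E.
  exact: sume_ge0.
have mfC : measurable_fun setT (fun t => (f (x C t) - fstar)%:E).
  exact: (mf (fun v => f v - fstar)).
have f0 t : (0 <= (f (x C t) - fstar)%:E)%E by rewrite lee_fin subr_ge0.
apply: (@le_trans _ _ (\int[P]_t U t)%E).
  apply: ge0_le_integral => //.
  - by move=> t _; rewrite lee_fin mulr_ge0 ?invr_ge0 ?sumr_ge0// => *; rewrite norm1_ge0.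
  - apply/measurable_EFinP; apply: measurable_funM => //.
    apply: measurable_sum => k; apply/measurable_EFinP.
    exact: (mf (fun v => norm1 (grad f v))).
  - apply: emeasurable_funD => //.
    by apply: emeasurable_funD; exact: measurable_funeM.
  - move=> t _; rewrite /U.
    have -> : (\sum_(k < K) (a k)%:E * (norm1 (noise k t))%:E =
        (\sum_(k < K) a k * norm1 (noise k t))%:E)%E.
      by rewrite -sumEFin; apply: eq_bigr => k _; rewrite EFinM.
    by rewrite -!EFinM -!EFinD lee_fin path.
rewrite /U ge0_integralD//; last 2 first.
- by move=> t _; rewrite adde_ge0// mule_ge0.
- by apply: emeasurable_funD; exact: measurable_funeM.
rewrite ge0_integralD//; last 4 first.
- by move=> t _; rewrite mule_ge0.
- exact: measurable_funeM.
- by move=> t _; rewrite mule_ge0.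
- exact: measurable_funeM.
rewrite !ge0_integralZl_EFin//.
rewrite integral_cst//= probability_setT mule1.
(* Here [f] may be negative, so the difference is split by integrability, which also makes [fine]
   harmless. *)
have If : (\int[P]_t (f (x C t) - fstar)%:E =
    (fine (\int[P]_t (f (x C t))%:E) - fstar)%:E)%E.
  under eq_integral do rewrite EFinB.
  rewrite integralB//; [|exact: integrable_signum_fun|
    exact: finite_measure_integrable_cst].
  rewrite integral_cst//= probability_setT mule1 EFinB fineK//.
  by apply: integrable_fin_num => //; exact: integrable_signum_fun.
have In : (\int[P]_t (\sum_(k < K) (a k)%:E * (norm1 (noise k t))%:E)
    <= (Ssum * H)%:E)%E.
  rewrite ge0_integral_sum// mulr_sumr -sumEFin; apply: lee_sum => k _.
  rewrite ge0_integralZl_EFin//; last by move=> t _; rewrite lee_fin norm1_ge0.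
  rewrite expr2 mulrCA EFinM lee_wpmul2l ?lee_fin//.
  exact: (expected_norm1_noise _ _ _ _ sigma_ge0 iG EG VG mxi xi_mu indep).
rewrite If; apply: (@le_trans _ _ (c1%:E * (fine (\int[P]_t (f (x C t))%:E) - fstar)%:E
  + c2%:E * (Ssum * H)%:E + c3%:E)%E).
  by rewrite leeD2r// leeD2l// lee_wpmul2l ?lee_fin.
rewrite -!EFinM -!EFinD lee_fin le_eqVlt; apply/orP; left; apply/eqP.
by rewrite /c1 /c2 /c3; field; rewrite !gt_eqF.
Qed.

End ExpectedGradient.

(** * The rate in terms of the number of oracle calls *)

Lemma sqr_sqrt_div_le (R : realType) (C K : nat) : (0 < C)%N -> (2 * C <= K)%N ->
  (Num.sqrt K%:R / (K - C)%:R) ^+ 2 <=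
  4 / Num.sqrt (\sum_(k < K) k.+1)%:R :> R.
Proof.
move=> C0 CK; have K0 : (0 < K)%N by lia.
have KR : 0 < K%:R :> R by rewrite ltr0n.
have NK : (0 < \sum_(k < K) k.+1 <= K ^ 2)%N.
  apply/andP; split; first by
    case: K K0 {CK KR} => // K _; rewrite big_ord_recr addn_gt0 orbT.
  rewrite (leq_trans (n := \sum_(k < K) K))//; last first.
    by rewrite sum_nat_const card_ord mulnn.
  by apply: leq_sum => k _; exact: ltn_ord.
have /andP[N0 N1] := NK.
have q0 : 0 < Num.sqrt (\sum_(k < K) k.+1)%:R :> R by rewrite sqrtr_gt0 ltr0n.
have qK : Num.sqrt (\sum_(k < K) k.+1)%:R <= K%:R :> R.
  rewrite -[leRHS]ger0_norm// -sqrtr_sqr ler_sqrt ?sqr_ge0//.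
  by rewrite -natrX ler_nat.
apply: (@le_trans _ _ (4 / K%:R)); last by rewrite ler_wpM2l// lef_pV2.
rewrite expr_div_n sqr_sqrtr ?ler0n//.
(* From [2 * C <= K], warmup takes at most half of the steps; this is the source of the factor 4. *)
have h : K%:R <= 2 * (K - C)%:R :> R by rewrite -natrM ler_nat; lia.
have p : 0 < (K - C)%:R :> R by rewrite ltr0n; lia.
by rewrite ler_pdivrMr ?exprn_gt0// mulrAC ler_pdivlMr//; nra.
Qed.

Theorem theorem3 (R : realType) (beta : R) (hbeta : 0 < beta < 1)
  (C : nat) (hC : is_signum_C beta C) :
  exists (A : R) (K0 : nat), 0 < A /\
  forall (d : nat) (f : 'rV[R]_d -> R) (fstar : R) (L sigma : 'I_d -> R)
    (delta : R) (x0 : 'rV[R]_d)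
    (dO : measure_display) (Omega : measurableType dO) (mu : probability Omega R)
    (G : 'rV[R]_d -> Omega -> 'rV[R]_d)
    (dT : measure_display) (T : measurableType dT) (P : probability T R)
    (xi : nat -> nat -> T -> Omega),
    (* f is C^2 *)
    twice_cont_diff f ->
    (* Assumption 1 *)
    (forall x, fstar <= f x) ->
    (* Assumption 2 *)
    (forall i, 0 <= L i) ->
    (forall x y, `| f y - f x - \sum_(i < d) grad f x ord0 i * (y ord0 i - x ord0 i) |
                 <= 2^-1 * \sum_(i < d) L i * (y ord0 i - x ord0 i) ^+ 2) ->
    (* Assumption 3: oracle answer at x is G x omega, omega ~ mu *)
    (forall i, 0 <= sigma i) ->
    (forall i, measurable_fun setT
                 (fun p : (borel_rV R d * Omega)%type => G p.1 p.2 ord0 i)) ->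
    (forall x i, mu.-integrable setT (fun om => (G x om ord0 i)%:E)) ->
    (forall x i, (\int[mu]_om (G x om ord0 i)%:E = (grad f x ord0 i)%:E)%E) ->
    (forall x i, (\int[mu]_om ((G x om ord0 i - grad f x ord0 i) ^+ 2)%:E
                  <= (sigma i ^+ 2)%:E)%E) ->
    (* the oracle calls: i.i.d. noises with law mu *)
    (forall k j, measurable_fun setT (xi k j)) ->
    (forall k j (B : set Omega), measurable B -> P (xi k j @^-1` B) = mu B) ->
    mutually_independent P (fun p : nat * nat => xi p.1 p.2) ->
    0 < delta ->
    forall K : nat, (K0 <= K)%N ->
    let x := fun (k : nat) (t : T) =>
               signum_iter G beta delta C x0 (fun k j => xi k j t) k in
    let N : R := (\sum_(k < K) k.+1)%:R in
    let lhs := (\int[P]_t ((K - C)%:R^-1 *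
                   \sum_(C <= k < K) norm1 (grad f (x k t)))%:E)%E in
    let B := ((\int[P]_t (f (x C t))%:E - fstar%:E) * (delta^-1)%:E +
              ((1 + ln N) * (delta * (\sum_(i < d) L i) / (1 - beta) +
                            (\sum_(i < d) sigma i) * Num.sqrt (1 - beta)))%:E)%E in
    (lhs * lhs <= (A / Num.sqrt N)%:E * (B * B))%E.
Proof.
have /andP[beta0 beta1] := hbeta.
have b0 : 0 < 1 - beta by rewrite subr_gt0.
have [C0 _] := hC.
(* Large enough to dominate the coefficients of all three error terms, even after the noise term
   gains [sqrt (1 - beta)]. *)
pose c := 8 / (1 - beta) ^+ 3.
have c0 : 0 < c by rewrite divr_gt0 ?exprn_gt0.
(* The 4 comes from [sqr_sqrt_div_le] and [c] is squared with the bound. The threshold depends on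
   [beta] only, as [C] does. *)
exists (4 * c ^+ 2), (2 * C)%N; split; first by rewrite mulr_gt0 ?exprn_gt0.
move=> d f fstar L sigma delta x0 dO Omega mu G dT T P xi _ f_ge L0 smooth
  sigma0 _ iG EG VG mxi xi_mu indep delta0 K CK.
cbv beta zeta.
set lhs := (X in (X * _ <= _)%E); set N := (\sum_(k < K) k.+1)%:R.
set B := ((\int[P]_t _ - fstar%:E) * _ + _)%E.
pose x k t := signum_iter G beta delta C x0 (fun k j => xi k j t) k.
have CK' : (C < K)%N by lia.
have := expected_norm1_signum_grad x0 f_ge L0 smooth sigma0 iG EG VG mxi xi_mu
  indep hbeta delta0 CK'.
rewrite -/lhs.
have iF := @integrable_signum_fun _ _ beta delta C x0 _ _ mu G _ _ P xi
  iG mxi C f.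
have Ef_fin := integrable_fin_num measurableT iF.
set Ef := (\int[P]_t _)%E in Ef_fin.
set H := \sum_(k < K) _; set Lsum := \sum_(i < d) L i.
set Ssum := \sum_(i < d) sigma i; set r := Num.sqrt _ / _ => lhs_le.
pose M := (1 + ln N) * (delta * Lsum / (1 - beta) + Ssum * Num.sqrt (1 - beta)).
pose D := (fine Ef - fstar) / delta.
have BE : B = (D + M)%:E.
  by rewrite /B -/Ef EFinD; congr (_ + _)%E; rewrite /D EFinM EFinB fineK.
(* Nonnegativity allows [D] to be enlarged to [c * D]. *)
have D0 : 0 <= D.
  rewrite divr_ge0 ?(ltW delta0)// subr_ge0 -lee_fin fineK//.
  apply: (@le_trans _ _ (\int[P]_t (cst fstar%:E) t)%E).
    by rewrite integral_cst//= probability_setT mule1.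
  apply: le_integral => //.
  - exact: finite_measure_integrable_cst.
  - by move=> t _; rewrite lee_fin f_ge.
have r0 : 0 <= r by rewrite divr_ge0 ?sqrtr_ge0.
have HE : H = \sum_(k < K) (k.+1%:R)^-1.
  by apply: eq_bigr => k _; rewrite exprVn sqr_sqrtr.
have H0 : 0 <= H by rewrite HE; apply: sumr_ge0 => k _; rewrite invr_ge0.
have KN : (K <= \sum_(k < K) k.+1)%N.
  apply: (@leq_trans (\sum_(k < K) 1)%N); last exact: leq_sum.
  by rewrite sum_nat_const card_ord muln1.
have K0 : (0 < K)%N by exact: leq_ltn_trans CK'.
(* The harmonic sum gives [ln K], and [K] is at most the number of oracle calls. *)
have HN : H <= 1 + ln N.
  rewrite HE; apply: le_trans (_ : _ <= 1 + ln K%:R) _.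
    by rewrite -(prednK K0) harmonic_le_ln.
  by rewrite lerD2l ler_ln ?posrE ?ltr0n ?ler_nat// (leq_trans K0).
have Lsum0 : 0 <= Lsum by exact: sumr_ge0.
have Ssum0 : 0 <= Ssum by exact: sumr_ge0.
pose b := 1 - beta.
have b1 : b <= 1 by rewrite gerBl ltW.
have sb : b <= Num.sqrt b.
  rewrite -[leLHS]ger0_norm ?(ltW b0)// -sqrtr_sqr ler_sqrt ?(ltW b0)//.
  by rewrite expr2 ler_piMl// ltW.
have c1 : 1 <= c.
  rewrite /c ler_pdivlMr ?exprn_gt0// mul1r.
  by rewrite (le_trans (exprn_ile1 _ _ _))// ?ler1n// ltW.
have cS : 2 / b ^+ 2 <= c * Num.sqrt b.
  apply: (@le_trans _ _ (c * b)); last by rewrite ler_wpM2l// ltW.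
  have -> : c * b = 8 / b ^+ 2 by rewrite /c -/b; field; rewrite gt_eqF.
  by rewrite ler_wpM2r ?invr_ge0 ?sqr_ge0// ler_nat.
(* After multiplication by [b ^+ 4] the claim reads [b ^+ 4 / 2 + 6 * b ^+ 2 <= 8], which holds
   since [b ^+ 2 <= 1]. *)
have cL : 2^-1 + 6 / b ^+ 2 <= c / b.
  have -> : c / b = 8 / b ^+ 2 / b ^+ 2 by rewrite /c -/b; field; rewrite gt_eqF.
  rewrite ler_pdivlMr ?exprn_gt0// ler_pdivlMr ?exprn_gt0//.
  have -> : (2^-1 + 6 / b ^+ 2) * b ^+ 2 * b ^+ 2 =
      2^-1 * b ^+ 2 * b ^+ 2 + 6 * b ^+ 2 by field; rewrite gt_eqF.
  have b2 : b ^+ 2 <= 1 by rewrite exprn_ile1// ltW.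
  have b20 : 0 <= b ^+ 2 by exact: sqr_ge0.
  nra.
have M0 : 0 <= M.
  rewrite mulr_ge0 ?(le_trans H0 HN)//.
  by rewrite addr_ge0 ?divr_ge0 ?mulr_ge0 ?sqrtr_ge0// ltW.
have main : D + 2 / b ^+ 2 * (Ssum * H) +
    (2^-1 + 6 / b ^+ 2) * delta * Lsum * H <= c * (D + M).
  rewrite mulrDr -addrA lerD//; first by rewrite ler_peMl.
  rewrite /M -/b.
  have -> : c * ((1 + ln N) * (delta * Lsum / b + Ssum * Num.sqrt b)) =
    (c * Num.sqrt b) * (Ssum * (1 + ln N)) +
    (c / b) * delta * Lsum * (1 + ln N) by ring.
  have dL : 0 <= delta * Lsum by rewrite mulr_ge0// ltW.
  rewrite lerD//.
    rewrite ler_pM ?mulr_ge0 ?invr_ge0 ?sqr_ge0//.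
    by rewrite ler_wpM2l.
  rewrite -!(mulrA _ delta) ler_pM ?mulr_ge0 ?(ltW delta0)//.
    by rewrite addr_ge0 ?mulr_ge0 ?invr_ge0 ?sqr_ge0.
  by rewrite ler_wpM2r.
have lhs0 : (0 <= lhs)%E.
  apply: integral_ge0 => t _; rewrite lee_fin mulr_ge0 ?invr_ge0//.
  by apply: sumr_ge0 => k _; exact: norm1_ge0.
have {}lhs_le : (lhs <= (r * (c * (D + M)))%:E)%E.
  by apply: le_trans lhs_le _; rewrite lee_fin ler_wpM2l.
apply: le_trans (lee_pmul lhs0 lhs0 lhs_le lhs_le) _.
rewrite BE -!EFinM lee_fin.
have -> : r * (c * (D + M)) * (r * (c * (D + M))) =
  r ^+ 2 * (c ^+ 2 * (D + M) ^+ 2) by ring.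
have -> : 4 * c ^+ 2 / Num.sqrt N * ((D + M) * (D + M)) =
  4 / Num.sqrt N * (c ^+ 2 * (D + M) ^+ 2) by ring.
apply: ler_wpM2r; first by rewrite mulr_ge0 ?sqr_ge0.
exact: sqr_sqrt_div_le.
Qed.
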